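(* Let $k\geq 2$ and $n\ge 1$ be integers. In every $k$-coloring of the edges of the complete graph $K_n$, there is a monochromatic connected component with at least $\frac{1}{k^2-k+\frac{5}{4}}\binom{n}{2}$ edges. Equivalently, $M(n,k)\geq \frac{1}{k^2-k+\frac{5}{4}}\binom{n}{2}$.
   Context: A $k$-coloring of the edges of $K_n$ is an arbitrary map from $E(K_n)$ to a set of $k$ colors (it need not be proper). A monochromatic connected component is a connected component of the spanning subgraph of $K_n$ formed by all edges of a single color. $M(n,k)$ denotes the largest integer $M$ such that every $k$-coloring of the edges of $K_n$ has a monochromatic connected component with at least $M$ edges. *)

(* Defs.v *)
From HB Require Import structures.
From mathcomp Require Import all_boot all_order all_algebra.

Set Implicit Arguments.
Unset Strict Implicit.
Unset Printing Implicit Defensive.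

(* Edges of K_n: the two-element subsets of the vertex set 'I_n. *)
Definition edge (n : nat) := {e : {set 'I_n} | #|e| == 2}.

Definition coloring (n k : nat) := {ffun edge n -> 'I_k}.

(* Adjacency in the spanning subgraph of K_n formed by the edges of color i. *)
Definition color_adj (n k : nat) (c : coloring n k) (i : 'I_k) : rel 'I_n :=
  fun x y => [exists e : edge n, (val e == [set x; y]) && (c e == i)].

(* Every vertex, isolated ones included, lies in exactly one component of each
   color. *)
Definition mono_component (n k : nat) (c : coloring n k) (i : 'I_k)
  (x : 'I_n) : {set 'I_n} :=
  [set y | connect (color_adj c i) x y].

(* Only the edges of color i count: the component may span edges of K_n that
   have other colors. *)
Definition mono_component_edges (n k : nat) (c : coloring n k) (i : 'I_k)
  (x : 'I_n) : {set edge n} :=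
  [set e : edge n | (c e == i) && (val e \subset mono_component c i x)].

Definition has_mono_component_geq (n k : nat) (c : coloring n k) (m : nat) : bool :=
  [exists i : 'I_k, exists x : 'I_n, m <= #|mono_component_edges c i x|].

(* The range of m loses nothing when 0 < n and 0 < k, since K_n has only
   'C(n, 2) edges: see M_forced and M_largest. *)
Definition M (n k : nat) : nat :=
  \max_(m < 'C(n, 2).+1 |
        [forall c : coloring n k, has_mono_component_geq c m]) m.

Lemma card_edge (n : nat) : #|{: edge n}| = 'C(n, 2).
Proof.
rewrite card_sig -[X in 'C(X, 2)]card_ord -card_draws.
by apply: eq_card => e; rewrite !inE.
Qed.

Lemma M_forced (n k : nat) (c : coloring n k) :
  0 < n -> 0 < k -> has_mono_component_geq c (M n k).
Proof.
move=> n0 k0.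
pose P (m : 'I_('C(n, 2).+1)) :=
  [forall d : coloring n k, has_mono_component_geq d m].
have P0 : P ord0.
  by apply/forallP => d; apply/existsP; exists (Ordinal k0);
     apply/existsP; exists (Ordinal n0).
have -> : M n k = val [arg max_(m > ord0 | P m) m] by exact: bigmax_eq_arg.
by case: arg_maxnP => // m /forallP/(_ c).
Qed.

Lemma M_largest (n k m : nat) :
  0 < k -> (forall c : coloring n k, has_mono_component_geq c m) -> m <= M n k.
Proof.
move=> k0 Hm.
have lem : m < 'C(n, 2).+1.
  have /existsP[i /existsP[x le_m]] := Hm [ffun=> Ordinal k0].
  by rewrite ltnS -card_edge (leq_trans le_m) // max_card.
apply: (@leq_bigmax_cond _ _ (fun j => nat_of_ord j) (Ordinal lem)).
exact/forallP.
Qed.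

(* Main.v *)
(* Write q = k^2 - k + 5/4 and suppose that every monochromatic component has at
   most N / q edges, N = 'C(n, 2).  If a graph H lies in a complete multipartite
   graph G and its components have at most m edges each, then
   e(H)^2 <= m e(G): the number of G-edges between two vertex sets satisfies a
   reverse Cauchy-Schwarz inequality.  Let i be a color with at least N / k
   edges, and let the components of color i have y_j n vertices.  The edges
   between distinct components form a complete multipartite graph colored with
   the k - 1 other colors, so it has at most (k - 1)^2 N / q edges, which bounds
   1 - sum_j y_j^2 from above.  On the other hand component j has at most
   min(1 / q, y_j^2) N edges of color i; as these add up to at least N / k, no y_j
   exceeds q^(-1/2) by much, which bounds sum_j y_j^2 from above.  The two bounds
   are incompatible. *)
Require Import Defs.
From mathcomp Require Import all_boot all_order all_algebra.
From mathcomp Require Import ring lra.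
Import Order.TTheory GRing.Theory Num.Theory.
Local Open Scope ring_scope.
Set Implicit Arguments.
Unset Strict Implicit.
Unset Printing Implicit Defensive.

(** * The bilinear form of a complete multipartite graph *)

Section ReverseCauchySchwarz.
Variables (R : realFieldType) (T T' : finType) (a : T -> T').
Implicit Types f g : T -> R.

(** The adjacency form of the complete multipartite graph whose parts are the fibers of [a]; on
    indicators it counts ordered adjacent pairs. *)
Definition cross f g : R := \sum_x \sum_y (a x != a y)%:R * (f x * g y).

Lemma crossC f g : cross f g = cross g f.
Proof.
rewrite /cross exchange_big /=; apply: eq_bigr => x _; apply: eq_bigr => y _.
by rewrite eq_sym [f y * _]mulrC.
Qed.

Lemma cross_ge0 f g :
  (forall x, 0 <= f x) -> (forall x, 0 <= g x) -> 0 <= cross f g.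
Proof.
move=> f0 g0; apply: sumr_ge0 => x _; apply: sumr_ge0 => y _.
by rewrite !mulr_ge0 ?ler0n.
Qed.

(** All pairs minus the pairs inside one fiber; for [f = g] this is one square minus a sum of
    squares. *)
Lemma crossE f g :
  cross f g = (\sum_x f x) * (\sum_x g x)
    - \sum_j (\sum_(x | a x == j) f x) * (\sum_(x | a x == j) g x).
Proof.
have -> : \sum_j (\sum_(x | a x == j) f x) * (\sum_(x | a x == j) g x)
        = \sum_x \sum_y (a x == a y)%:R * (f x * g y).
  rewrite [RHS](partition_big a xpredT) //=; apply: eq_bigr => j _.
  rewrite mulr_suml; apply: eq_bigr => x /eqP ax.
  rewrite mulr_sumr big_mkcond /=; apply: eq_bigr => y _.
  by rewrite ax eq_sym; case: eqP => _; rewrite ?mul1r ?mul0r.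
rewrite mulr_suml -sumrB; apply: eq_bigr => x _.
rewrite mulr_sumr -sumrB; apply: eq_bigr => y _.
by case: eqP => _; rewrite ?mul1r ?mul0r ?subrr ?subr0.
Qed.

Lemma cross_sub (p q : R) f g :
  cross (fun x => q * f x - p * g x) (fun x => q * f x - p * g x)
  = q ^+ 2 * cross f f - 2 * p * q * cross f g + p ^+ 2 * cross g g.
Proof.
have -> : 2 * p * q * cross f g = p * q * cross f g + p * q * cross g f.
  by rewrite (crossC g f); ring.
rewrite /cross !mulr_sumr -big_split /= -sumrB -big_split /=.
apply: eq_bigr => x _.
rewrite !mulr_sumr -big_split /= -sumrB -big_split /=.
by apply: eq_bigr => y _; ring.
Qed.

(* [q f - p g], with [p] and [q] the total masses of [f] and [g], has mass 0,
   and [cross] is nonpositive on the diagonal at such functions. *)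
Lemma cross_reverse_CS f g :
  (forall x, 0 <= f x) -> (forall x, 0 <= g x) ->
  cross f f * cross g g <= cross f g ^+ 2.
Proof.
move=> f0 g0.
have neg h : \sum_x h x = 0 -> cross h h <= 0.
  move=> h0; rewrite crossE h0 mul0r sub0r oppr_le0.
  by apply: sumr_ge0 => j _; rewrite -expr2 sqr_ge0.
have ff := cross_ge0 f0 f0; have gg := cross_ge0 g0 g0.
have fg := cross_ge0 f0 g0.
set p := \sum_x f x; set q := \sum_x g x.
have p0 : 0 <= p by exact: sumr_ge0.
have q0 : 0 <= q by exact: sumr_ge0.
have [pz|pN] := eqVneq p 0.
  by rewrite (le_trans _ (sqr_ge0 _)) // mulr_le0_ge0 // neg.
have [qz|qN] := eqVneq q 0.
  by rewrite (le_trans _ (sqr_ge0 _)) // mulr_ge0_le0 // neg.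
have : cross (fun x => q * f x - p * g x) (fun x => q * f x - p * g x) <= 0.
  by apply: neg; rewrite sumrB -!mulr_sumr -/p -/q mulrC subrr.
rewrite cross_sub; move: (cross f f) (cross g g) (cross f g) ff gg fg.
move=> X Y Z X0 Y0 Z0 le_Z.
have pq : 0 < (2 * p * q) ^+ 2 
  by rewrite exprn_gt0 // !mulr_gt0 ?ltr0n // lt0r ?pN ?qN.
rewrite -(ler_pM2l pq) -exprMn.
(* Nonpositivity bounds [q ^+ 2 * X + p ^+ 2 * Y] by [2 * p * q * Z]. After squaring,
   [4 A B <= (A + B) ^ 2] for the two summands concludes. *)
have : (q ^+ 2 * X + p ^+ 2 * Y) ^+ 2 <= (2 * p * q * Z) ^+ 2.
  by apply: lerXn2r; rewrite ?nnegrE ?addr_ge0 ?mulr_ge0 ?sqr_ge0 //; lra.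
apply: le_trans; rewrite -subr_ge0.
have -> : (q ^+ 2 * X + p ^+ 2 * Y) ^+ 2 - (2 * p * q) ^+ 2 * (X * Y)
  = (q ^+ 2 * X - p ^+ 2 * Y) ^+ 2 by ring.
exact: sqr_ge0.
Qed.

(** * Edge counts of subgraphs of a multipartite graph *)

(* Ordered pairs: an edge counts twice. *)
Definition nbpairs (H : rel T) : R := \sum_x \sum_y (H x y)%:R.

Lemma nbpairs_ge0 H : 0 <= nbpairs H.
Proof. by apply: sumr_ge0 => x _; apply: sumr_ge0 => y _; rewrite ler0n. Qed.

Lemma nbpairs_partition (T2 : finType) (v : T -> T2) (H : rel T) :
  nbpairs H = \sum_j nbpairs (fun x y => H x y && (v x == j)).
Proof.
rewrite /nbpairs (partition_big v xpredT) //=; apply: eq_bigr => j _.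
rewrite big_mkcond; apply: eq_bigr => x _.
case: eqP => _; first by under [RHS]eq_bigr do rewrite andbT.
by under [RHS]eq_bigr do rewrite andbF; rewrite big1.
Qed.

Lemma ler_nbpairs (H H' : rel T) :
  (forall x y, H x y -> H' x y) -> nbpairs H <= nbpairs H'.
Proof.
move=> HH'; apply: ler_sum => x _; apply: ler_sum => y _.
by rewrite ler_nat; case: (H x y) (HH' x y) => [->|] //.
Qed.

(* In applications [v x] is the component of [x] in a graph containing [H]. *)
Lemma sqr_nbpairs_multipartite (T2 : finType) (v : T -> T2) (H : rel T) (m : R) :
  (forall x y, H x y -> v x = v y) -> (forall x y, H x y -> a x != a y) ->
  (forall j, nbpairs (fun x y => H x y && (v x == j)) <= m) ->
  nbpairs H ^+ 2 <= m * nbpairs (fun x y => a x != a y).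
Proof.
move=> Hv Ha Hm.
pose ind j x : R := (v x == j)%:R.
have ind0 j x : 0 <= ind j x by rewrite ler0n.
have sum_ind x : \sum_j ind j x = 1.
  rewrite /ind (bigD1 (v x)) //= eqxx big1 ?addr0 // => j.
  by rewrite eq_sym => /negbTE ->.
have -> : nbpairs (fun x y => a x != a y) = \sum_j \sum_l cross (ind j) (ind l).
  rewrite /nbpairs /cross; under [RHS]eq_bigr do rewrite exchange_big /=.
  rewrite [RHS]exchange_big /=; apply: eq_bigr => x _.
  under [RHS]eq_bigr do rewrite exchange_big /=.
  rewrite [RHS]exchange_big /=; apply: eq_bigr => y _.
  under [RHS]eq_bigr do rewrite -mulr_sumr -mulr_sumr sum_ind mulr1.
  by rewrite -mulr_sumr sum_ind mulr1.
(* Both sides become sums over pairs of classes [j], [l] of [v], compared term by term. *)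
rewrite (nbpairs_partition v H) expr2 mulr_suml mulr_sumr.
apply: ler_sum => j _; rewrite mulr_sumr mulr_sumr; apply: ler_sum => l _.
pose h j := nbpairs (fun x y => H x y && (v x == j)).
have h0 i : 0 <= h i by exact: nbpairs_ge0.
have hc i : h i <= cross (ind i) (ind i).
  apply: ler_sum => x _; apply: ler_sum => y _.
  rewrite /ind -!natrM ler_nat.
  case: (boolP (H x y)) => //= Hxy.
  by rewrite (Ha _ _ Hxy) -(Hv _ _ Hxy) mul1n; case: eqP.
have m0 : 0 <= m by exact: le_trans (h0 j) (Hm j).
have c0 : 0 <= cross (ind j) (ind l) by exact: cross_ge0.
rewrite -/(h j) -/(h l).
(* [h j * h l] is at most [m ^+ 2] and, by the reverse inequality, at most
   [cross (ind j) (ind l) ^+ 2]; the two bounds are multiplied. *)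
rewrite -ler_sqr ?nnegrE ?mulr_ge0 //.
rewrite [(m * _) ^+ 2]exprMn expr2.
apply: ler_pM; rewrite ?mulr_ge0 //.
  by rewrite expr2 ler_pM ?Hm.
by apply: le_trans (cross_reverse_CS (ind0 j) (ind0 l)); rewrite ler_pM.
Qed.

End ReverseCauchySchwarz.

(** * Numerical estimates *)

(** To be applied with [y j] the share of the vertices in component [j], [h j] the share of ordered
    pairs it joins in the dense color, and [s * (1 - d) = 1 / k]. *)
Lemma sum_sqr_le (R : realFieldType) (J : finType) (y h : J -> R) (s d : R) :
  0 < s -> (forall j, 0 <= y j) -> \sum_j y j = 1 ->
  (forall j, h j <= s ^+ 2) -> (forall j, h j <= y j ^+ 2) ->
  s * (1 - d) <= \sum_j h j ->
  \sum_j y j ^+ 2 <= s + (s + d) * d.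
Proof.
move=> s0 y0 y1 hs hy hd.
(* The excess [e] of [y] over [s] costs [s * e] in [h], hence is at most [d]. *)
pose e j := Num.max 0 (y j - s).
have e0 j : 0 <= e j by rewrite le_max lexx.
pose D := \sum_j e j.
have D0 : 0 <= D by exact: sumr_ge0.
have eD j : e j <= D by rewrite /D (bigD1 j) //= lerDl sumr_ge0.
have Dd : D <= d.
  have : \sum_j h j <= \sum_j (s * y j - s * e j).
    apply: ler_sum => j _; have := hs j; have := hy j; have := y0 j; rewrite /e.
    by case: (leP 0 (y j - s)) => [le_s|lt_s] yj hyj hsj; nra.
  by rewrite sumrB -!mulr_sumr y1 -/D; nra.
(* Where [y j >= s], [y j ^+ 2 = s * y j + y j * e j] and [y j = s + e j <= s + D]; elsewhere
   [e j = 0]. *)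
apply: (@le_trans _ _ (\sum_j (s * y j + (s + D) * e j))).
  apply: ler_sum => j _; have := eD j; have := y0 j; rewrite /e.
  by case: (leP 0 (y j - s)) => [le_s|lt_s] yj eDj; nra.
by rewrite big_split /= -!mulr_sumr y1 -/D; nra.
Qed.

(* [s] is a rational stand-in for [(k ^+ 2 - k + 5 / 4) ^- (1/2)]: with
   [w = 2 k - 1], [1 / s] is the convergent [w / 2 + 1 / (w + 1 / w)] of
   [sqrt ((w / 2) ^ 2 + 1)]. *)
Lemma rational_threshold (R : realFieldType) (k s d : R) : 2 <= k ->
  s = 2 * ((2 * k - 1) ^+ 2 + 1) / ((2 * k - 1) * ((2 * k - 1) ^+ 2 + 3)) ->
  d = 1 - 1 / (k * s) ->
  [/\ 0 < s, 1 / (k ^+ 2 - k + 5 / 4) <= s ^+ 2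
    & s + (s + d) * d < 1 - (k - 1) ^+ 2 * s ^+ 2].
Proof.
move=> k2 sE dE; set w := 2 * k - 1 in sE.
have w3 : 3 <= w by rewrite /w; lra.
have kE : k = (w + 1) / 2 by rewrite /w; field.
have w0 : 0 < w by lra.
have u1 : 0 < w ^+ 2 + 1 by nra.
have u3 : 0 < w ^+ 2 + 3 by nra.
have s0 : 0 < s by rewrite sE !(mulr_gt0, invr_gt0) // ltr0n.
have dE' : d = (w - 1) ^+ 2 / ((w + 1) * (w ^+ 2 + 1)).
  rewrite dE sE kE; field.
  by rewrite !gt_eqF //; lra.
split => //.
  have -> : k ^+ 2 - k + 5 / 4 = (w ^+ 2 + 4) / 4 by rewrite kE; field.
  have u4 : 0 < w ^+ 2 + 4 by nra.
  rewrite -subr_ge0.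
  (* [(w ^ 2 + 1) ^ 2 (w ^ 2 + 4)] exceeds [w ^ 2 (w ^ 2 + 3) ^ 2] by exactly 4. *)
  have -> : s ^+ 2 - 1 / ((w ^+ 2 + 4) / 4)
     = 16 / ((w * (w ^+ 2 + 3)) ^+ 2 * (w ^+ 2 + 4)).
    by rewrite sE; field; rewrite !gt_eqF.
  by rewrite !(mulr_ge0, invr_ge0, exprn_ge0) ?ler0n // ltW.
rewrite -subr_gt0.
(* The numerator is grouped so that every bracket is positive for [w >= 3]. *)
have -> : 1 - (k - 1) ^+ 2 * s ^+ 2 - (s + (s + d) * d) =
    (w ^+ 8 * (8 * w - 13) + w ^+ 6 * (44 * w - 48) + w ^+ 4 * (68 * w - 58)
      + w ^+ 2 * (20 * w - 20) + (12 * w * (w - 1) - 1))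
    / ((w * (w ^+ 2 + 3)) * ((w + 1) * (w ^+ 2 + 1))) ^+ 2.
  rewrite sE dE' kE; field.
  by rewrite !gt_eqF //; lra.
have w1 : 0 < w + 1 by lra.
rewrite divr_gt0 ?exprn_gt0 ?mulr_gt0 //.
apply: addr_gt0; last by nra.
by do 3?[apply: addr_gt0]; rewrite mulr_gt0 ?exprn_gt0 //; lra.
Qed.

(** * Pair counts for the components of a coloring *)

Section MonoComponents.
Variables (R : realFieldType) (n k : nat) (c : coloring n k).
Implicit Types (i : 'I_k) (x y : 'I_n).

Lemma color_adj_sym i : symmetric (color_adj c i).
Proof. by move=> x y; apply: eq_existsb => e; rewrite setUC. Qed.

Lemma color_adj_neq i x y : color_adj c i x y -> x != y.
Proof.
case/existsP => e /andP[/eqP eE _]; apply/eqP => xy.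
by have := valP e; rewrite /= eE xy setUid cards1.
Qed.

Lemma sum_color_adj x y : \sum_i (color_adj c i x y)%:R = (x != y)%:R :> R.
Proof.
have [->|xy] := eqVneq x y.
  rewrite big1 // => i _.
  by case: (boolP (color_adj c i y y)) => // /color_adj_neq; rewrite eqxx.
have e2 : #|[set x; y]| == 2%N by rewrite cards2 xy.
pose e : edge n := Sub [set x; y] e2.
rewrite (bigD1 (c e)) //= [X in X%:R]/= big1 => [|i ie].
  rewrite addr0; suff -> : color_adj c (c e) x y by [].
  by apply/existsP; exists e; rewrite !eqxx.
case: (boolP (color_adj c i x y)) => // /existsP[e' /andP[/eqP e'E /eqP ce']].
have ee' : e' = e by apply: val_inj.
by rewrite -ce' ee' eqxx in ie.
Qed.

Lemma mem_mono_component i x : x \in mono_component c i x.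
Proof. by rewrite inE connect0. Qed.

Lemma color_adj_component i x y :
  color_adj c i x y -> mono_component c i x = mono_component c i y.
Proof.
move=> xy; apply/setP => z; rewrite !inE; apply: same_connect.
  exact/sym_connect_sym/color_adj_sym.
exact: connect1.
Qed.

Lemma sum_edge_pairs (e : edge n) :
  \sum_x \sum_y (val e == [set x; y])%:R <= 2 :> R.
Proof.
have e2 : #|val e| == 2%N := valP e.
have /cards2P[p [q [pq eE]]] := e2.
have le1 x : \sum_y (val e == [set x; y])%:R <= (x \in val e)%:R :> R.
  have [xe|xNe] := boolP (x \in val e); last first.
    rewrite big1 // => y _; case: eqP => // exy.
    by rewrite exy set21 in xNe.
  have [z zE] : exists z, forall y, val e == [set x; y] -> y = z.
    move: xe; rewrite eE => /set2P[] ->; [exists q|exists p] => y /eqP/setP.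
      by move=> /(_ q); rewrite !inE eqxx orbT [q == p]eq_sym (negbTE pq) => /esym/eqP.
    by move=> /(_ p); rewrite !inE eqxx /= (negbTE pq) => /esym/eqP.
  rewrite (bigD1 z) //= big1 ?addr0 ?lern1 ?leq_b1 // => y yz.
  by case: (boolP (val e == _)) => // /zE yE; rewrite yE eqxx in yz.
apply: le_trans (ler_sum _ (fun x _ => le1 x)) _.
rewrite -natr_sum ler_nat.
suff -> : (\sum_x (x \in val e) = #|val e|)%N by rewrite (eqP e2).
by rewrite -sum1_card [RHS]big_mkcond; apply: eq_bigr => x _; case: ifP.
Qed.

Lemma nbpairs_component i x0 :
  nbpairs R (fun x y => color_adj c i x y
                        && (mono_component c i x == mono_component c i x0))
  <= 2 * #|mono_component_edges c i x0|%:R.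
Proof.
rewrite -sum1_card natr_sum mulr_sumr mulr1.
apply: le_trans (ler_sum _ (fun e _ => sum_edge_pairs e)).
rewrite exchange_big; apply: ler_sum => x _.
rewrite exchange_big; apply: ler_sum => y _.
case: (boolP (color_adj c i x y)) => [xy|_]; last exact: sumr_ge0.
case: eqP => [xx0|_]; last exact: sumr_ge0.
have yx0 := color_adj_component xy; rewrite xx0 in yx0.
have /existsP[e /andP[/eqP eE /eqP ce]] := xy.
rewrite (bigD1 e) /=; first by rewrite eE eqxx lerDl sumr_ge0.
rewrite inE ce eqxx eE /=; apply/subsetP => z /set2P[]->.
  by rewrite -xx0 mem_mono_component.
by rewrite yx0 mem_mono_component.
Qed.

Variable m : R.
Hypothesis m0 : 0 <= m.
Hypothesis comp_le : forall i x, #|mono_component_edges c i x|%:R <= m.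

(** Components are indexed by their vertex sets; a set [A] that is no component contributes 0. *)
Lemma nbpairs_component_le i (A : {set 'I_n}) :
  nbpairs R (fun x y => color_adj c i x y && (mono_component c i x == A))
  <= 2 * m.
Proof.
have [x0 /eqP <-|noA] := pickP (fun x => mono_component c i x == A).
  by apply: le_trans (nbpairs_component i x0) _; rewrite ler_pM2l.
rewrite /nbpairs big1 ?mulr_ge0 // => x _; rewrite big1 // => y _.
by rewrite noA andbF.
Qed.

(** Pairs between components of color [i0] carry the other [k - 1] colors, each on at most
    [sqrt (2 m E)] of them, so [E <= (k - 1) sqrt (2 m E)]. *)
Lemma nbpairs_cross_le i0 : (2 <= k)%N ->
  nbpairs R (fun x y => mono_component c i0 x != mono_component c i0 y)
  <= (k%:R - 1) ^+ 2 * (2 * m).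
Proof.
move=> k2; set E := nbpairs _ _.
pose e i := nbpairs R (fun x y => color_adj c i x y
                  && (mono_component c i0 x != mono_component c i0 y)).
have k1 : 0 < k%:R - 1 :> R by rewrite subr_gt0 ltr1n.
have e_le i : e i ^+ 2 <= 2 * m * E.
  apply: (sqr_nbpairs_multipartite (v := mono_component c i)).
  - by move=> x y /andP[/color_adj_component].
  - by move=> x y /andP[].
  move=> A; apply: le_trans (nbpairs_component_le i A).
  by apply: ler_nbpairs => x y /andP[/andP[-> _]].
have E0 : 0 <= E by exact: nbpairs_ge0.
have e0 i : 0 <= e i by exact: nbpairs_ge0.
have sum_e : \sum_(i | i != i0) e i = E.
  rewrite /e /nbpairs exchange_big; apply: eq_bigr => x _.
  rewrite exchange_big; apply: eq_bigr => y _.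
  case: (boolP (mono_component c i0 x != mono_component c i0 y)) => [xy|_]; last first.
    by rewrite big1 // => i _; rewrite andbF.
  under eq_bigr do rewrite andbT.
  have := sum_color_adj x y; rewrite (bigD1 i0) //=.
  case: (boolP (color_adj c i0 x y)) => [/color_adj_component xy'|_].
    by rewrite xy' eqxx in xy.
  by rewrite add0r => ->; rewrite (contraNneq _ xy) // => ->.
(* Square roots are avoided by contradiction: each other color would cover less than
   [E / (k - 1)]. *)
rewrite leNgt; apply/negP => lt_E.
have e_lt i : (k%:R - 1) * e i < E.
  rewrite ltNge; apply/negP => le_E.
  have := e_le i; have : E ^+ 2 <= ((k%:R - 1) * e i) ^+ 2.
    by apply: lerXn2r; rewrite ?nnegrE ?mulr_ge0 // ltW.
  rewrite exprMn => h1 h2.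
  have h3 : E * E <= (k%:R - 1) ^+ 2 * (2 * m) * E.
    by rewrite -expr2 -mulrA; apply: le_trans h1 _; rewrite ler_pM2l // exprn_gt0.
  have Epos : 0 < E.
    by apply: le_lt_trans lt_E; rewrite mulr_ge0 ?sqr_ge0 ?mulr_ge0.
  by rewrite ler_pM2r // leNgt lt_E in h3.
have : \sum_(i | i != i0) (k%:R - 1) * e i < \sum_(i | i != i0) E.
  have [i1 i1N] : exists i, i != i0.
    have /existsP[i] : [exists i, i != i0].
      rewrite -negb_forall; apply/negP => /forallP alli.
      have : (#|'I_k| <= 1)%N.
        by apply/card_le1_eqP => i j _ _; rewrite (eqP (alli i)) (eqP (alli j)).
      by rewrite card_ord leqNgt k2.
    by exists i.
  rewrite (bigD1 i1) //= [X in _ < X](bigD1 i1) //=.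
  by apply: ltr_leD => //; apply: ler_sum => i _; exact: ltW.
rewrite -mulr_sumr sum_e sumr_const cardC1 card_ord -[X in _ < X]mulr_natl.
by rewrite -subn1 natrB ?(ltnW k2) // ltxx.
Qed.

(** Averaging: the [k] colors share the [n (n - 1)] ordered pairs. *)
Lemma exists_dense_color : (0 < k)%N ->
  exists i, n%:R * (n%:R - 1) <= k%:R * nbpairs R (color_adj c i).
Proof.
move=> k0; apply/existsP; apply: contraT; rewrite negb_exists => /forallP lt_i.
have : \sum_i k%:R * nbpairs R (color_adj c i) < \sum_(i < k) n%:R * (n%:R - 1).
  apply: ltr_sum => [|i _]; last by rewrite ltNge lt_i.
  by apply/hasP; exists (Ordinal k0); rewrite ?mem_index_enum.
rewrite -mulr_sumr sumr_const card_ord -[X in _ < X]mulr_natl.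
rewrite ltr_pM2l ?ltr0n //.
suff -> : \sum_i nbpairs R (color_adj c i) = n%:R * (n%:R - 1) by rewrite ltxx.
rewrite /nbpairs exchange_big -[n in n%:R * _]card_ord mulr_natl -sumr_const.
apply: eq_bigr => x _; rewrite exchange_big /=.
under eq_bigr do rewrite sum_color_adj.
apply: (addrI 1); rewrite [RHS]addrC subrK -[in RHS](card_ord n) -sumr_const.
rewrite (bigD1 x) //= [RHS](bigD1 x) //= eqxx add0r; congr (_ + _).
by apply: eq_bigr => y; rewrite eq_sym => ->.
Qed.

Lemma nbpairs_le_class i (A : {set 'I_n})
  (a : R := #|[set x | mono_component c i x == A]|%:R) :
  nbpairs R (fun x y => color_adj c i x y && (mono_component c i x == A))
  <= a * (a - 1).
Proof.
set B := [set x | _] in a *.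
have -> : a * (a - 1) = \sum_(x in B) (a - 1) by rewrite sumr_const -mulr_natl.
rewrite /nbpairs [X in _ <= X]big_mkcond; apply: ler_sum => x _ /=.
rewrite inE; case: eqP => [xA|_]; last first.
  by under eq_bigr do rewrite andbF; rewrite big1.
have -> : a - 1 = \sum_(y in B | y != x) 1.
  rewrite /a -sum1_card natr_sum (bigD1 x) /= ?inE ?xA //.
  by rewrite [LHS]addrC addKr.
rewrite [X in _ <= X]big_mkcond /=; apply: ler_sum => y _.
rewrite andbT; case: (boolP (color_adj c i x y)) => [xy|_]; last by case: ifP.
rewrite inE -(color_adj_component xy) xA eqxx eq_sym.
by rewrite (color_adj_neq xy).
Qed.

(** The components are the fibers of [mono_component c i], so this is [crossE] at the constant
    function 1. *)
Lemma nbpairs_crossE i :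
  nbpairs R (fun x y => mono_component c i x != mono_component c i y)
  = n%:R ^+ 2 - \sum_A #|[set x | mono_component c i x == A]|%:R ^+ 2.
Proof.
transitivity (cross (mono_component c i) (fun=> 1) (fun=> 1 : R)).
  by apply: eq_bigr => x _; apply: eq_bigr => y _; rewrite !mulr1.
rewrite crossE -expr2 sumr_const card_ord; congr (_ - _).
apply: eq_bigr => A _; rewrite -expr2 -sum1_card natr_sum.
by congr (_ ^+ 2); apply: eq_bigl => x; rewrite inE.
Qed.

End MonoComponents.

(** * The contradiction and the bound on [M] *)

Lemma mono_component_large (R : realFieldType) (n k : nat) (c : coloring n k) :
  (2 <= k)%N -> (2 <= n)%N ->
  exists i x, 1 / (k%:R ^+ 2 - k%:R + 5 / 4) * 'C(n, 2)%:R
              <= #|mono_component_edges c i x|%:R :> R.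
Proof.
move=> k2 n2; set m := 1 / _ * _.
suff /existsP[i /existsP[x]] : [exists i, exists x,
    m <= #|mono_component_edges c i x|%:R] by exists i, x.
apply: contraT => /existsPn no_large.
have comp_le i x : #|mono_component_edges c i x|%:R <= m.
  by have /existsPn/(_ x) := no_large i; rewrite -ltNge => /ltW.
have k2R : 2 <= k%:R :> R by rewrite ler_nat.
have n2R : 2 <= n%:R :> R by rewrite ler_nat.
have n0 : 0 < n%:R :> R by lra.
have n1 : 0 < n%:R - 1 :> R by lra.
pose w : R := 2 * k%:R - 1.
pose s : R := 2 * (w ^+ 2 + 1) / (w * (w ^+ 2 + 3)).
pose d : R := 1 - 1 / (k%:R * s).
have [s0 q_le f_lt] : [/\ 0 < s, 1 / (k%:R ^+ 2 - k%:R + 5 / 4) <= s ^+ 2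
    & s + (s + d) * d < 1 - (k%:R - 1) ^+ 2 * s ^+ 2] by exact: rational_threshold.
have mE : 2 * m = 1 / (k%:R ^+ 2 - k%:R + 5 / 4) * (n%:R * (n%:R - 1)).
  have bin2R : 2 * 'C(n, 2)%:R = n%:R * (n%:R - 1) :> R.
    have bin2n : ('C(n, 2) * 2 = n * n.-1)%N.
      by rewrite -[n.-1]ffactn1 -ffactnS; exact: (bin_ffact n 2).
    by rewrite -natrM mulnC bin2n natrM -subn1 natrB // ltnW.
  by rewrite -bin2R /m mulrCA.
have m_le : 2 * m <= s ^+ 2 * (n%:R * (n%:R - 1)).
  by rewrite mE ler_pM2r ?mulr_gt0.
have m0 : 0 <= m.
  by apply: le_trans (comp_le (Ordinal (ltnW k2)) (Ordinal (ltnW n2))).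
have [i dense_i] := exists_dense_color R c (ltnW k2).
pose a A : R := #|[set x | mono_component c i x == A]|%:R.
pose h A := nbpairs R (fun x y => color_adj c i x y && (mono_component c i x == A)).
have a0 A : 0 <= a A by exact: ler0n.
have an A : a A <= n%:R by rewrite ler_nat -[X in (_ <= X)%N]card_ord max_card.
have sum_a : \sum_A a A = n%:R.
  rewrite -[in RHS](card_ord n) -sum1_card natr_sum.
  rewrite (partition_big (mono_component c i) xpredT) //=.
  apply: eq_bigr => A _; rewrite /a -sum1_card natr_sum.
  by apply: eq_bigl => x; rewrite inE.
pose N : R := n%:R * (n%:R - 1).
have N0 : 0 < N by rewrite mulr_gt0.
have sum_le : \sum_A (a A / n%:R) ^+ 2 <= s + (s + d) * d.
  apply: (sum_sqr_le (h := fun A => h A / N) s0).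
  - by move=> A; rewrite divr_ge0 ?ler0n.
  - by rewrite -mulr_suml sum_a divff ?gt_eqF.
  - move=> A; rewrite ler_pdivrMr //.
    exact: le_trans (nbpairs_component_le m0 comp_le i A) m_le.
  - move=> A; apply: (@le_trans _ _ (a A * (a A - 1) / N)).
      by rewrite ler_pM2r ?invr_gt0 // nbpairs_le_class.
    (* As [a A <= n], passing from [a (a - 1) / (n (n - 1))] to [(a / n) ^ 2] only increases the
       bound. *)
    rewrite -subr_ge0.
    have -> : (a A / n%:R) ^+ 2 - a A * (a A - 1) / N
              = a A * (n%:R - a A) / (n%:R ^+ 2 * (n%:R - 1)).
      by rewrite /N; field; rewrite !gt_eqF.
    by rewrite divr_ge0 ?mulr_ge0 ?(ltW n1) ?subr_ge0 ?sqr_ge0.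
  - rewrite -mulr_suml -nbpairs_partition ler_pdivlMr //.
    have k0 : 0 < k%:R :> R by lra.
    have -> : s * (1 - d) = k%:R^-1 by rewrite /d; field; rewrite !gt_eqF.
    by rewrite ler_pdivrMl.
have cross_le := nbpairs_cross_le m0 comp_le i k2.
rewrite nbpairs_crossE in cross_le.
move: sum_le; under eq_bigr do rewrite expr_div_n.
rewrite -mulr_suml ler_pdivrMr ?exprn_gt0 // => sum_le.
have le1 : (k%:R - 1) ^+ 2 * (2 * m) <= (k%:R - 1) ^+ 2 * s ^+ 2 * n%:R ^+ 2.
  rewrite -mulrA ler_wpM2l ?sqr_ge0 //; apply: le_trans m_le _.
  by rewrite ler_wpM2l ?sqr_ge0 //; nra.
have lt1 : (s + (s + d) * d) * n%:R ^+ 2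
    < (1 - (k%:R - 1) ^+ 2 * s ^+ 2) * n%:R ^+ 2.
  by rewrite ltr_pM2r // exprn_gt0.
suff : n%:R ^+ 2 < n%:R ^+ 2 :> R by rewrite ltxx.
(* The squares of the component sizes sum to at least [(1 - (k - 1) ^ 2 s ^ 2) n ^ 2] by [cross_le],
   and to strictly less by [sum_le]. *)
move: sum_le cross_le le1 lt1; rewrite /a mulrBl mul1r; lra.
Qed.

Theorem theorem1 (k n : nat) (hk : (2 <= k)%N) (hn : (1 <= n)%N) :
  (forall c : coloring n k,
     exists (i : 'I_k) (x : 'I_n),
       1 / (k%:R ^+ 2 - k%:R + 5 / 4) * 'C(n, 2)%:R
         <= #|mono_component_edges c i x|%:R :> rat)
  /\ 1 / (k%:R ^+ 2 - k%:R + 5 / 4) * 'C(n, 2)%:R <= (M n k)%:R :> rat.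
Proof.
have large (c : coloring n k) : exists i x,
    1 / (k%:R ^+ 2 - k%:R + 5 / 4) * 'C(n, 2)%:R
      <= #|mono_component_edges c i x|%:R :> rat.
  have [n2|n1] := leqP 2 n; first exact: mono_component_large.
  (* For [n = 1] there are no edges and the bound is 0. *)
  exists (Ordinal (ltnW hk)), (Ordinal hn).
  by rewrite bin_small // mulr0.
split=> //; set q := 1 / _ * _ in large *.
have k2 : 2 <= k%:R :> rat by rewrite ler_nat.
have q_le : exists m : nat, q <= m%:R.
  exists (Num.truncn q).+1; exact/ltW/truncnS_gt.
(* [M] is an integer, so [q] is rounded up to [m]; edge counts that reach [q] also reach [m]. *)
case: (ex_minnP q_le) => m q_m m_min.
apply: le_trans q_m _; rewrite ler_nat M_largest ?(ltnW hk) // => c.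
have [i [x q_x]] := large c.
by apply/existsP; exists i; apply/existsP; exists x; exact: m_min.
Qed.
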